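(* If $F$ is a $k$-graph which contains $K_{k+1}^k$ as a subgraph, then for all $r>k$, \[s(\mathrm{E}^r(F))\ge \frac{1}{r-k}.\] In particular, $\mathrm{E}^r(F)$ is not Sidorenko.
   Context: A $k$-graph is a $k$-uniform hypergraph; $K_{k+1}^k$ is the complete $k$-graph on $k+1$ vertices. For a $k$-graph $F$ and $r\ge k$, the expansion $\mathrm{E}^r(F)$ is the $r$-graph obtained by enlarging each edge of $F$ with a set of $r-k$ new vertices of degree one. A homomorphism from an $r$-graph $F$ to an $r$-graph $H$ is a map $\phi:V(F)\to V(H)$ sending every edge of $F$ to an edge of $H$; $t_F(H)=\hom(F,H)/v(H)^{v(F)}$. $K_r^r$ is the $r$-graph with a single edge. An $r$-graph $F$ is Sidorenko if $t_F(H)\ge t_{K_r^r}(H)^{e(F)}$ for all $r$-graphs $H$. $s(F):=\sup\{s:\ \exists\, r\text{-graph } H \text{ with } t_F(H)=t_{K_r^r}(H)^{s+e(F)}>0\}$.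
   Formalization: The uniformity k is assumed to be at least 2 (the usual convention); for k = 1 the claim fails, since the expansion of K_2^1 is two disjoint r-edges, which is Sidorenko with s = 0. *)

(* Defs.v *)
From HB Require Import structures.
From mathcomp Require Import all_boot all_order all_algebra.
From mathcomp Require Import boolp classical_sets reals ereal exp.

Set Implicit Arguments.
Unset Strict Implicit.
Unset Printing Implicit Defensive.
Import Order.TTheory GRing.Theory Num.Theory.

Record kgraph (k : nat) := KGraph {
  vertex : finType;
  edges : {set {set vertex}};
  edges_uniform : forall e : {set vertex}, e \in edges -> #|e| = k }.

Definition complete_edges (n k : nat) : {set {set 'I_n}} :=
  [set e : {set 'I_n} | #|e| == k].

Lemma complete_uniform (n k : nat) (e : {set 'I_n}) :
  e \in complete_edges n k -> #|e| = k.
Proof. by rewrite inE => /eqP. Qed.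

Definition complete (n k : nat) : kgraph k := KGraph (@complete_uniform n k).

Definition is_hom (k : nat) (F H : kgraph k)
    (phi : {ffun vertex F -> vertex H}) : bool :=
  [forall e in edges F, (phi @: e) \in edges H].

(* Subgraphs are not required to be induced. *)
Definition has_subgraph (k : nat) (K F : kgraph k) : Prop :=
  exists2 phi : {ffun vertex K -> vertex F}, injective phi & is_hom phi.

Section Expansion.
Variables (k r : nat) (le_kr : k <= r) (F : kgraph k).

(* [inr (e, i)] is the i-th new vertex attached to the edge [e]. *)
Definition expansion_vertex : finType :=
  (vertex F + {e : {set vertex F} | e \in edges F} * 'I_(r - k))%type.

Definition expanded_edge (e : {e : {set vertex F} | e \in edges F}) :
    {set expansion_vertex} :=
  [set inl v | v in val e] :|: [set inr (e, i) | i : 'I_(r - k)].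

Definition expansion_edges : {set {set expansion_vertex}} :=
  [set expanded_edge e | e : {e : {set vertex F} | e \in edges F}].

Lemma expansion_uniform (e : {set expansion_vertex}) :
  e \in expansion_edges -> #|e| = r.
Proof.
case/imsetP=> f _ ->; rewrite cardsU.
have -> : [set inl v | v in val f] :&: [set inr (f, i) | i : 'I_(r - k)]
    = finset.set0 :> {set expansion_vertex}.
  apply/setP=> x; rewrite !inE; apply/negP=> /andP[].
  by case/imsetP=> v _ -> /imsetP[].
rewrite cards0 subn0 !card_imset; first last.
- by move=> i j [].
- by move=> u v [].
by rewrite card_ord (edges_uniform (valP f)) subnKC.
Qed.

Definition expansion : kgraph r := KGraph expansion_uniform.

End Expansion.

Local Open Scope ring_scope.

Definition hom_count (k : nat) (F H : kgraph k) : nat :=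
  #|[set phi : {ffun vertex F -> vertex H} | is_hom phi]|.

Definition hom_density (R : realType) (k : nat) (F H : kgraph k) : R :=
  (hom_count F H)%:R / #|vertex H|%:R ^+ #|vertex F|.

(* In the next two definitions H must have a vertex, since its densities are
   otherwise not defined. *)
Definition sidorenko (R : realType) (r : nat) (F : kgraph r) : Prop :=
  forall H : kgraph r, (0 < #|vertex H|)%N ->
    hom_density R (complete r r) H ^+ #|edges F| <= hom_density R F H.

(* The supremum is taken in the extended reals because it can be infinite. *)
Definition sidorenko_gap (R : realType) (r : nat) (F : kgraph r) : \bar R :=
  ereal_sup [set s%:E | s in [set s : R | exists H : kgraph r,
    [/\ (0 < #|vertex H|)%N,
        hom_density R F H
          = powR (hom_density R (complete r r) H) (s + #|edges F|%:R)
      & 0 < hom_density R F H]]]%classic.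

(* Main.v *)
Require Import Defs.
From mathcomp Require Import all_boot all_order all_algebra.
From mathcomp Require Import zify ring lra.
From mathcomp Require Import boolp reals ereal sequences exp.
Set Implicit Arguments.
Unset Strict Implicit.
Unset Printing Implicit Defensive.
Import Order.TTheory GRing.Theory Num.Theory.
Local Open Scope ring_scope.

(* Take a hypergraph H on n vertices whose edges are the r-subsets of a family
   of blocks of bounded size such that k vertices lie in at most one common
   block, and such that k+1 vertices all of whose k-subsets lie in blocks lie
   in a single block. A homomorphism from E^r(F) to H is then determined, up to
   boundedly many choices, by the images of all but one vertex of F: the last
   vertex of a copy of K_{k+1}^k lies in the block of the other k, and the new
   vertices of an edge lie in the block of that edge. Hence t_{E^r(F)}(H) is
   O(n^{-1-(r-k)e(F)}), and if there are n^{k-o(1)} blocks then the edge density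
   is n^{-(r-k)-o(1)}, so the exponent is e(F) + 1/(r-k) - o(1).

   Such blocks are obtained in the manner of Ruzsa-Szemeredi and Behrend: the
   blocks are graphs over {0,...,c-1} of vector-valued polynomials of degree
   less than k whose leading coefficients range over a paraboloid. Interpolation
   shows that the polynomials attached to the k-subsets of a (k+1)-clique have
   collinear leading coefficients; strict convexity makes these coincide. Taking
   c at least the number of vertices of E^r(F) makes the homomorphism count
   positive without any partiteness assumption on F. *)

(** * Interpolation and strict convexity *)

Lemma poly_eq_on_roots (R : idomainType) (p q : {poly R}) (xs : seq R) :
  uniq xs -> (size p <= size xs)%N -> (size q <= size xs)%N ->
  {in xs, forall x, p.[x] = q.[x]} -> p = q.
Proof.
move=> uxs sp sq eq_pq; apply/eqP; rewrite -subr_eq0; apply/eqP.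
apply: (roots_geq_poly_eq0 (rs := xs)) => //.
  by apply/allP=> x /eq_pq E; rewrite /root hornerD hornerN E subrr.
by rewrite (leq_trans (size_polyD _ _)) // size_polyN geq_max sp.
Qed.

Lemma size_XsubCM_leq (R : idomainType) (a : R) (p : {poly R}) (n : nat) :
  (size p <= n)%N -> (size (('X - a%:P) * p)%R <= n.+1)%N.
Proof.
by move=> sp; apply: leq_trans (size_polyMleq _ _) _; rewrite size_XsubC.
Qed.

Lemma coef_XsubCM (R : idomainType) (a : R) (p : {poly R}) (n : nat) :
  (size p <= n.+1)%N -> (('X - a%:P) * p)`_n.+1 = p`_n.
Proof.
by move=> sp; rewrite mulrBl coefB coefXM coefCM /= [p`_n.+1]nth_default // mulr0 subr0.
Qed.

(* Neville's recursion: [(X - x_0) p_0 - (X - x_1) p_1] is [x_1 - x_0] times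
   the interpolant through all [n+2] nodes, and so is the same expression with
   1 replaced by 2, up to the factor [x_2 - x_0]. *)
Lemma interpolant_coef_collinear (R : idomainType) (n : nat)
    (x y : 'I_n.+2 -> R) (p : 'I_n.+2 -> {poly R}) (i j l : 'I_n.+2) :
  injective x -> (forall h, (size (p h) <= n.+1)%N) ->
  (forall h h', h' != h -> (p h).[x h'] = y h') ->
  ((p i)`_n - (p j)`_n) * (x l - x i) = ((p i)`_n - (p l)`_n) * (x j - x i).
Proof.
move=> x_inj sp py.
pose f h := ('X - (x h)%:P) * p h.
(* The factor ['X - x h] kills the one node where [p h] is unconstrained, so this formula holds at
   all [n+2] nodes. *)
have fE h h' : (f h).[x h'] = (x h' - x h) * y h'.
  rewrite hornerM hornerXsubC; case: (eqVneq h' h) => [->|ne].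
    by rewrite subrr !mul0r.
  by rewrite py.
have sf h : (size (f h) <= n.+2)%N by apply: size_XsubCM_leq.
have sg h h' a : (size (a *: (f h - f h'))%R <= n.+2)%N.
  apply: leq_trans (size_scale_leq _ _) _.
  by rewrite (leq_trans (size_polyD _ _)) // size_polyN geq_max !sf.
have := @poly_eq_on_roots R ((x l - x i) *: (f i - f j))
  ((x j - x i) *: (f i - f l)) (map x (enum 'I_n.+2)).
rewrite size_map size_enum_ord (map_inj_uniq x_inj) enum_uniq => E.
have {}E : (x l - x i) *: (f i - f j) = (x j - x i) *: (f i - f l).
  apply: E => // _ /mapP[h _ ->].
  by rewrite !hornerZ !hornerD !hornerN !fE; ring.
move/(congr1 (fun q : {poly R} => q`_n.+1)): E.
by rewrite !coefZ !coefB !coef_XsubCM // => E; rewrite mulrC E mulrC.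
Qed.

(* The points [(a, |a|^2)] form a strictly convex surface, hence no three
   distinct ones are collinear. *)
Lemma paraboloid_collinear (R : realDomainType) (I : finType)
    (a b c : I -> R) (u v : R) :
  u != 0 -> u != v ->
  (forall d, (a d - b d) * u = (a d - c d) * v) ->
  (\sum_d a d ^+ 2 - \sum_d b d ^+ 2) * u
    = (\sum_d a d ^+ 2 - \sum_d c d ^+ 2) * v ->
  a =1 b.
Proof.
move=> u0 uv lin; rewrite -!sumrB => quad d.
(* The vector [c] enters only through [(a - c) * v], which [lin] replaces by [(a - b) * u]; hence
   the multiplication by [v]. *)
have: u * (u - v) * \sum_d (a d - b d) ^+ 2 = 0.
  transitivity (v * ((\sum_d (a d ^+ 2 - b d ^+ 2)) * u
      - (\sum_d (a d ^+ 2 - c d ^+ 2)) * v)); last by rewrite quad subrr mulr0.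
  rewrite !mulr_suml mulr_sumr -sumrB mulr_sumr; apply: eq_bigr => h _.
  have := lin h; move: (a h) (b h) (c h) => a' b' c' E.
  have: v * (v * (a' ^+ 2 - c' ^+ 2)) =
     2 * a' * v * ((a' - c') * v) - ((a' - c') * v) ^+ 2 by ring.
  rewrite -E => E'.
  have -> : v * ((a' ^+ 2 - b' ^+ 2) * u - (a' ^+ 2 - c' ^+ 2) * v) =
     v * ((a' ^+ 2 - b' ^+ 2) * u) - v * (v * (a' ^+ 2 - c' ^+ 2)) by ring.
  by rewrite E'; ring.
move/eqP; rewrite !mulf_eq0 (negbTE u0) subr_eq0 (negbTE uv) /=.
rewrite psumr_eq0 => [/allP/(_ d)|h _]; last exact: sqr_ge0.
by rewrite mem_index_enum sqrf_eq0 subr_eq0 => /(_ isT)/eqP.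
Qed.

(** * Hypergraphs built from blocks *)

(* A [t]-block is the graph of [L t]; the edges of the hypergraph below are
   the r-subsets of the blocks. *)
Definition block_edges (I Y T : finType) (L : T -> I -> Y) (r : nat) :
    {set {set (I * Y)}} :=
  [set e : {set (I * Y)} | (#|e| == r)
    && [exists t, e \subset [set (i, L t i) | i : I]]].

Lemma block_uniform (I Y T : finType) (L : T -> I -> Y) (r : nat)
    (e : {set (I * Y)}) : e \in block_edges L r -> #|e| = r.
Proof. by rewrite inE => /andP[/eqP]. Qed.

Definition block_graph (I Y T : finType) (L : T -> I -> Y) (r : nat) :
  kgraph r := KGraph (@block_uniform I Y T L r).

Definition blocks_determined (I Y T : finType) (L : T -> I -> Y) (k : nat) :=
  forall (t t' : T) (S : {set I}), (k <= #|S|)%N ->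
    {in S, L t =1 L t'} -> t = t'.

(** [s j] is the block through the k-subset of the clique that omits vertex [j]; its value at [f j]
    is left open. *)
Definition cliques_in_blocks (I Y T : finType) (L : T -> I -> Y) (k : nat) :=
  forall (f : 'I_k.+1 -> I) (y : 'I_k.+1 -> Y) (s : 'I_k.+1 -> T),
    injective f -> (forall j l, l != j -> L (s j) (f l) = y l) ->
    exists t, forall l, L t (f l) = y l.

Section BlockGraph.
Variables (I Y T : finType) (L : T -> I -> Y) (r : nat).
Let H := block_graph L r.

(** The image still has [r] elements, so [phi] is injective on [e]; inside a graph, the first
    coordinate determines the point. *)
Lemma block_edge_image (A : finType) (e : {set A}) (phi : A -> I * Y) :
  #|e| = r -> phi @: e \in edges H ->
  exists t, {in e, forall v, phi v = ((phi v).1, L t (phi v).1)}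
    /\ {in e &, injective (fun v => (phi v).1)}.
Proof.
move=> ce; rewrite inE => /andP[/eqP cphi /existsP[t /subsetP sub]].
have phiE : {in e, forall v, phi v = ((phi v).1, L t (phi v).1)}.
  by move=> v ve; have /sub/imsetP[i _ ->] := imset_f phi ve.
exists t; split=> // v w ve we /= eq_vw.
have /imset_injP phi_inj : #|phi @: e| == #|e| by rewrite cphi ce.
by apply: phi_inj => //; rewrite phiE // [RHS]phiE // eq_vw.
Qed.

Lemma graph_map_is_hom (F : kgraph r) (f : vertex F -> I) (t : T) :
  injective f ->
  @is_hom r F H [ffun v => (f v, L t (f v))].
Proof.
move=> f_inj; apply/forallP=> e; apply/implyP=> eF; rewrite inE.
rewrite card_imset; last by move=> v w; rewrite !ffunE => -[/f_inj].
rewrite (edges_uniform eF) eqxx; apply/existsP; exists t.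
apply/subsetP=> _ /imsetP[v _ ->]; rewrite ffunE.
by apply/imsetP; exists (f v).
Qed.

Lemma block_hom_gt0 (F : kgraph r) :
  (#|vertex F| <= #|I|)%N -> (0 < #|T|)%N -> (0 < hom_count F H)%N.
Proof.
move=> leFI /card_gt0P[t _].
pose f (v : vertex F) : I := enum_val (widen_ord leFI (enum_rank v)).
have f_inj : injective f.
  by move=> v w /enum_val_inj/(congr1 val)/= /val_inj/enum_rank_inj.
apply/card_gt0P; exists [ffun v => (f v, L t (f v))].
by rewrite inE graph_map_is_hom.
Qed.

(** Along one fixed injection into [I], each block gives a homomorphism, and its [r >= k] values
    recover the block. *)
Lemma block_edge_hom_ge (k : nat) :
  blocks_determined L k -> (k <= r <= #|I|)%N ->
  (#|T| <= hom_count (complete r r) H)%N.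
Proof.
move=> det /andP[le_kr leI].
have leI' : (#|'I_r| <= #|I|)%N by rewrite card_ord.
pose f (v : 'I_r) : I := enum_val (widen_ord leI' (enum_rank v)).
have f_inj : injective f.
  by move=> v w /enum_val_inj/(congr1 val)/= /val_inj/enum_rank_inj.
pose g (t : T) : {ffun vertex (complete r r) -> vertex H} :=
  [ffun v => (f v, L t (f v))].
rewrite -cardsT -(card_imset _ (_ : injective g)).
  apply/subset_leq_card/subsetP=> _ /imsetP[t _ ->].
  by rewrite inE; apply: graph_map_is_hom.
move=> t t' /ffunP gE; apply: (det _ _ [set f v | v : 'I_r]).
  by rewrite card_imset // card_ord.
by move=> _ /imsetP[v _ ->]; have := gE v; rewrite !ffunE => -[].
Qed.

(** A constant map is not a homomorphism. The resulting edge density below 1 makes its logarithm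
    negative. *)
Lemma block_edge_hom_lt :
  (1 < r)%N -> (0 < #|vertex H|)%N ->
  (hom_count (complete r r) H < #|vertex H| ^ r)%N.
Proof.
move=> r1 /card_gt0P[v _].
have -> : (#|vertex H| ^ r)%N = #|{ffun vertex (complete r r) -> vertex H}|.
  by rewrite card_ffun card_ord.
rewrite -cardsT; apply/proper_card/properP; split; first exact: subsetT.
exists [ffun=> v]; rewrite !inE //; apply/forallP=> /(_ [set: 'I_r]%SET).
rewrite !inE /= cardsT card_ord eqxx => /andP[/eqP c1 _].
suff: (r <= #|[set v]|)%N by rewrite cards1 leqNgt r1.
apply: leq_trans (eq_leq (esym c1)) _.
by apply/subset_leq_card/subsetP=> _ /imsetP[u _ ->]; rewrite ffunE inE.
Qed.

Lemma expansion_hom_le (k : nat) (hkr : (k < r)%N) (F : kgraph k) :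
  (1 < k)%N -> blocks_determined L k -> cliques_in_blocks L k ->
  has_subgraph (complete k.+1 k) F ->
  (hom_count (expansion (ltnW hkr) F) H <=
   #|vertex H| ^ (#|vertex F|).-1 * #|I| ^ (1 + #|edges F| * (r - k)))%N.
Proof.
move=> k1 det cliq [gam gam_inj gam_hom].
set E := expansion _ _; pose v0 := gam ord0.
pose EF := {e : {set vertex F} | e \in edges F}.
(* Full images are recorded only for the old vertices other than [v0]; for [v0] and the new vertices
   the first coordinate suffices, as their blocks supply the second. *)
pose code (phi : {ffun vertex E -> vertex H}) :
  {ffun {v | v != v0} -> vertex H} * {ffun option (EF * 'I_(r - k)) -> I} :=
  ([ffun v => phi (inl (val v))],
   [ffun o => if o is Some x then (phi (inr x)).1 else (phi (inl v0)).1]).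
have bl (phi : {ffun vertex E -> vertex H}) (e : EF) : is_hom phi -> exists t,
    {in expanded_edge r e, forall v,
       phi v = ((phi v).1, L t (phi v).1)}
    /\ {in expanded_edge r e &, injective (fun v => (phi v).1)}.
  move=> /forallP/(_ (expanded_edge r e))/implyP phi_hom.
  have eE : expanded_edge r e \in edges E by apply: imset_f.
  exact: block_edge_image (edges_uniform eE) (phi_hom eE).
have inlE (e : EF) v : v \in val e ->
    (inl v : vertex E) \in expanded_edge r e.
  by move=> ve; rewrite inE imset_f.
have inrE (e : EF) i : (inr (e, i) : vertex E) \in expanded_edge r e.
  by rewrite inE; apply/orP; right; apply/imsetP; exists i.
have ge_sub (j : 'I_k.+1) : gam @: [set~ j]%SET \in edges F.
  by apply: (implyP (forallP gam_hom _)); rewrite inE cardsC1 card_ord.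
pose ge (j : 'I_k.+1) : EF :=
  exist (fun e : {set vertex F} => e \in edges F) _ (ge_sub j).
have geE j l : l != j -> gam l \in val (ge j).
  by move=> lj; apply: imset_f; rewrite !inE.
have cliqE (phi : {ffun vertex E -> vertex H}) : is_hom phi -> exists t, forall l,
    phi (inl (gam l)) = ((phi (inl (gam l))).1, L t (phi (inl (gam l))).1).
  move=> hom.
  have [s sP] := choice (fun j => bl phi (ge j) hom).
  have [||t tP] := cliq (fun l => (phi (inl (gam l))).1)
     (fun l => (phi (inl (gam l))).2) s.
  (* Since [k+1 >= 3], some clique vertex [l] differs from both; the edge omitting [l] contains the
     other two, and first coordinates are injective on it. *)
  - move=> i j eq_ij.
    have [l] : exists l : 'I_k.+1, l \notin [set i; j]%SET.
      apply/existsP; rewrite -[X in is_true X]negbK negb_exists.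
      apply/negP => /forallP all_ij.
      have: (#|[set: 'I_k.+1]| <= #|[set i; j]|)%N.
        by apply/subset_leq_card/subsetP=> l _; have := all_ij l; rewrite negbK.
      by rewrite cardsT card_ord cards2; case: eqP => _ /=; lia.
    rewrite !inE negb_or => /andP[li lj].
    apply: gam_inj; have [_ inj] := sP l.
    have: inl (gam i) = inl (gam j) :> vertex E.
      by apply: inj eq_ij; apply/inlE/geE; rewrite eq_sym.
    by case.
  - move=> j l lj; have [phiE _] := sP j.
    by rewrite {2}phiE //; apply/inlE/geE.
  by exists t => l; rewrite tP; case: (phi _).
have same (e : EF) (phi phi' : {ffun vertex E -> vertex H}) t t' : is_hom phi ->
    {in val e, forall v, phi (inl v) = phi' (inl v)} ->
    {in val e, forall v, phi (inl v) = ((phi (inl v)).1, L t (phi (inl v)).1)} ->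
    {in val e, forall v, phi' (inl v) = ((phi' (inl v)).1, L t' (phi' (inl v)).1)} ->
    t = t'.
  move=> hom eq_e phiE phiE'; have [_ [_ inj]] := bl phi e hom.
  apply: (det _ _ [set (phi (inl v)).1 | v in val e]).
    rewrite card_in_imset; first by rewrite (edges_uniform (valP e)).
    move=> v w ve we eq_vw.
    have: inl v = inl w :> vertex E by apply: inj eq_vw; apply: inlE.
    by case.
  move=> _ /imsetP[v ve ->].
  have := phiE' v ve; rewrite -eq_e // {1}phiE // => -[]; done.
have code_inj : {in [set phi | is_hom phi]%SET &, injective code}.
  move=> phi phi'; rewrite !inE => hom hom' [/ffunP eq1 /ffunP eq2].
  have eqF v : v != v0 -> phi (inl v) = phi' (inl v).
    by move=> vv0; have := eq1 (Sub v vv0); rewrite !ffunE.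
  (* The edge [ge ord0] avoids [v0], so both maps already agree on it, and its [k] vertices fix the
     block of the whole clique. *)
  have eq0 : phi (inl v0) = phi' (inl v0).
    have [[t tP] [t' tP']] := (cliqE phi hom, cliqE phi' hom').
    have tt' : t = t'.
      apply: (same (ge ord0) phi phi') => // v /imsetP[l]; rewrite !inE => l0 ->.
      - by rewrite eqF //; apply: contra l0 => /eqP/gam_inj ->.
      - exact: tP.
      - exact: tP'.
    have := eq2 None; rewrite !ffunE => eq0.
    by rewrite /v0 tP tP' tt' -/v0 eq0.
  have eqV v : phi (inl v) = phi' (inl v).
    by case: (eqVneq v v0) => [->|/eqF].
  apply/ffunP=> -[v|[e i]] //.
  have [[t [tP _]] [t' [tP' _]]] := (bl phi e hom, bl phi' e hom').
  have tt' : t = t'.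
    apply: (same e phi phi') => // v ve; first exact: (tP (inl v) (inlE e v ve)).
    exact: (tP' (inl v) (inlE e v ve)).
  have := eq2 (Some (e, i)); rewrite !ffunE => eqi.
  by rewrite (tP _ (inrE e i)) (tP' _ (inrE e i)) tt' eqi.
rewrite /hom_count -(card_in_imset code_inj).
apply: leq_trans (max_card _) _.
rewrite card_prod !card_ffun card_option !card_prod card_ord.
by rewrite !card_sig (cardC1 v0) add1n.
Qed.

End BlockGraph.

Lemma card_expansion_vertex (k r : nat) (le_kr : (k <= r)%N) (F : kgraph k) :
  #|vertex (expansion le_kr F)| = (#|vertex F| + #|edges F| * (r - k))%N.
Proof. by rewrite card_sum card_prod card_ord card_sig. Qed.

Lemma card_expansion_edges (k r : nat) (le_kr : (k <= r)%N) (F : kgraph k) :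
  #|edges (expansion le_kr F)| = #|edges F|.
Proof.
rewrite card_imset; first by rewrite card_sig.
move=> e f /setP eq_ef; apply/val_inj/setP=> v.
have inlE (g : {e : {set vertex F} | e \in edges F}) :
    ((inl v : expansion_vertex r F) \in expanded_edge r g) = (v \in val g).
  rewrite inE mem_imset; last by move=> ? ? [].
  by case: imsetP => [[]|]; rewrite ?orbF.
by rewrite -!inlE eq_ef.
Qed.

(** * Blocks from polynomials over a grid *)

Section Grid.
Variables (K D c m : nat).

(** The range [m ^ 2] of the low coefficients matches the order of the squared norm that will be the
    top coefficient. *)
Definition grid_index : finType :=
  ({ffun 'I_D -> {ffun 'I_K.+1 -> 'I_m}} * {ffun 'I_K -> 'I_(m ^ 2)})%type.

(* [grid_coef t (Some d)] is a free polynomial of degree at most K; in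
   [grid_coef t None] only the coefficients below degree K are free, the top
   one being the squared norm of the top coefficients of the others. *)
Definition grid_coef (t : grid_index) (o : option 'I_D) (j : nat) : nat :=
  match o with
  | Some d => t.1 d (inord j)
  | None => if insub j is Some j' then nat_of_ord (t.2 j')
            else (\sum_d t.1 d ord_max ^ 2)%N
  end.

Definition grid_eval (t : grid_index) (o : option 'I_D) (x : nat) : nat :=
  (\sum_(j < K.+1) grid_coef t o j * x ^ j)%N.

Definition grid_poly (t : grid_index) (o : option 'I_D) : {poly int} :=
  \poly_(j < K.+1) (grid_coef t o j)%:Z.

Definition grid_bound : nat := (K.+1 * c ^ K * m)%N.
Definition grid_bound2 : nat := (K.+1 * c ^ K * (D * m ^ 2))%N.

Definition grid_value : finType :=
  ({ffun 'I_D -> 'I_grid_bound.+1} * 'I_grid_bound2.+1)%type.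

Definition grid_line (t : grid_index) (i : 'I_c) : grid_value :=
  ([ffun d => inord (grid_eval t (Some d) i)], inord (grid_eval t None i)).

Lemma grid_polyE t o (x : nat) :
  (grid_poly t o).[x%:Z] = (grid_eval t o x)%:Z.
Proof.
rewrite horner_poly /grid_eval -[RHS]natz natr_sum; apply: eq_bigr => j _.
by rewrite natrM natrX !natz.
Qed.

Lemma size_grid_poly t o : (size (grid_poly t o) <= K.+1)%N.
Proof. exact: size_poly. Qed.

Lemma grid_poly_coef t o j : (j <= K)%N ->
  (grid_poly t o)`_j = (grid_coef t o j)%:Z.
Proof. by move=> jK; rewrite coef_poly ltnS jK. Qed.

Lemma grid_coef_low t (j : 'I_K) : grid_coef t None j = t.2 j.
Proof. by rewrite /= valK. Qed.

Lemma grid_coef_top t : grid_coef t None K = (\sum_d t.1 d ord_max ^ 2)%N.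
Proof. by rewrite /= insubF ?ltnn. Qed.

Lemma grid_poly_inj t t' : grid_poly t =1 grid_poly t' -> t = t'.
Proof.
move=> eq_t.
have eqc o (j : nat) : (j <= K)%N -> grid_coef t o j = grid_coef t' o j.
  by move=> jK; have := congr1 (fun p : {poly int} => p`_j) (eq_t o);
    rewrite /= !grid_poly_coef // => -[].
rewrite [t]surjective_pairing [t']surjective_pairing; congr (_, _).
  apply/ffunP=> d; apply/ffunP=> j; apply/val_inj.
  by have := eqc (Some d) j (ltn_ord j); rewrite /= inord_val.
by apply/ffunP=> j; apply/val_inj; rewrite /= -!grid_coef_low eqc // ltnW.
Qed.

Lemma grid_eval_le t o (x : nat) (b : nat) :
  (x <= c)%N -> (0 < c)%N -> (forall j, grid_coef t o j <= b)%N ->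
  (grid_eval t o x <= K.+1 * c ^ K * b)%N.
Proof.
move=> xc c0 le_b; rewrite -mulnA -[K.+1 in X in (_ <= X)%N]card_ord -sum_nat_const.
apply: leq_sum => j _; rewrite mulnC leq_mul //.
apply: (@leq_trans (c ^ j)); last by rewrite leq_pexp2l // -ltnS.
by case: (nat_of_ord j) => // n; rewrite leq_exp2r.
Qed.

(** The bounds in [grid_value] dominate every evaluation on the grid, so [inord] never falls back to
    its default and the integer values can be read off. *)
Lemma grid_line_eq t t' (i i' : 'I_c) : (0 < D)%N ->
  grid_line t i = grid_line t' i' ->
  forall o, grid_eval t o i = grid_eval t' o i'.
Proof.
move=> D0 [/ffunP eq1 /(congr1 val)/= eq2].
have c0 : (0 < c)%N by apply: leq_ltn_trans (ltn_ord i).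
have bnd1 s (h : 'I_c) d : (grid_eval s (Some d) h < grid_bound.+1)%N.
  by rewrite ltnS grid_eval_le // => [|j]; apply/ltnW/ltn_ord.
have bnd2 s (h : 'I_c) : (grid_eval s None h < grid_bound2.+1)%N.
  rewrite ltnS grid_eval_le // => [|j]; first exact/ltnW/ltn_ord.
  rewrite /=; case: insubP => [j' _ _|_].
    by apply: leq_trans (leq_pmull _ D0); apply/ltnW/ltn_ord.
  rewrite -[D in X in (_ <= X)%N]card_ord -sum_nat_const; apply: leq_sum => d _.
  by rewrite leq_exp2r // ltnW.
case=> [d|]; last by move: eq2; rewrite !inordK.
by have := congr1 val (eq1 d); rewrite !ffunE /= !inordK.
Qed.

Lemma grid_determined : (0 < D)%N -> blocks_determined grid_line K.+1.
Proof.
move=> D0 t t' S leS eqS; apply: grid_poly_inj => o.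
apply: (@poly_eq_on_roots _ _ _ [seq (nat_of_ord i)%:Z | i <- enum S]).
- rewrite map_inj_uniq ?enum_uniq //.
  by move=> i j [] /val_inj.
- by rewrite size_map -cardE (leq_trans (size_grid_poly _ _)).
- by rewrite size_map -cardE (leq_trans (size_grid_poly _ _)).
move=> x /mapP[i]; rewrite mem_enum => /eqS eqi ->{x}.
by rewrite !grid_polyE (grid_line_eq D0 eqi).
Qed.

Lemma grid_cliques : (0 < K)%N -> (0 < D)%N -> cliques_in_blocks grid_line K.+1.
Proof.
move=> K0 D0 f y s f_inj sy.
pose x (l : 'I_K.+2) : int := (nat_of_ord (f l))%:Z.
have x_inj : injective x by move=> l l' [] /val_inj/f_inj.
have eqx l l' : (x l == x l') = (l == l') by apply: inj_eq.
(* Every block except [s l] takes the prescribed value at node [l]; [other l] selects one, to name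
   that value as an integer [z l o]. *)
pose other (l : 'I_K.+2) : 'I_K.+2 := if l == ord0 then ord_max else ord0.
have other_ne l : l != other l by rewrite /other; case: (eqVneq l ord0) => // ->.
pose z l o : int := (grid_eval (s (other l)) o (f l))%:Z.
have sz o j l : l != j -> (grid_poly (s j) o).[x l] = z l o.
  move=> lj; rewrite grid_polyE; congr _%:Z; apply: (grid_line_eq D0).
  by rewrite !sy.
pose i0 : 'I_K.+2 := ord0; pose i1 : 'I_K.+2 := inord 1.
pose i2 : 'I_K.+2 := ord_max.
have i1E : val i1 = 1%N by rewrite /= inordK.
have col o := interpolant_coef_collinear i0 i1 i2 x_inj
   (fun h => size_grid_poly (s h) o) (sz o).
have top d : (s i0).1 d ord_max = (s i1).1 d ord_max.
  have := @paraboloid_collinear int 'I_D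
     (fun d => ((s i0).1 d ord_max)%:Z) (fun d => ((s i1).1 d ord_max)%:Z)
     (fun d => ((s i2).1 d ord_max)%:Z) (x i2 - x i0) (x i1 - x i0).
  have sq j : \sum_d ((s j).1 d ord_max)%:Z ^+ 2 = (grid_poly (s j) None)`_K.
    rewrite grid_poly_coef // grid_coef_top -[RHS]natz natr_sum.
    by apply: eq_bigr => h _; rewrite natrX natz.
  rewrite !sq col => /(_ _ _ _ erefl d) E; apply/val_inj; suff [] : 
    ((s i0).1 d ord_max)%:Z = ((s i1).1 d ord_max)%:Z by [].
  apply: E => [||h].
  - by rewrite subr_eq0 eqx.
  (* The nodes [i1] and [i2] have indices 1 and [K+1], distinct because [K > 0]. *)
  - by rewrite (inj_eq (addIr _)) eqx -val_eqE i1E /= eqSS -lt0n.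
  have := col (Some h); rewrite !grid_poly_coef //=.
  have -> : inord K = ord_max :> 'I_K.+1 by apply/val_inj; rewrite /= inordK.
  by [].
(* With equal top coefficients the difference has degree below [K], and it vanishes at the [K] nodes
   other than [i0] and [i1]. *)
have s01 : s i0 = s i1.
  apply: grid_poly_inj => o.
  have topE : (grid_poly (s i0) o)`_K = (grid_poly (s i1) o)`_K.
    rewrite !grid_poly_coef //; case: o => [d|].
      rewrite /=; have -> : inord K = ord_max :> 'I_K.+1
        by apply/val_inj; rewrite /= inordK.
      by rewrite top.
    by rewrite !grid_coef_top; congr _%:Z; apply: eq_bigr => d _; rewrite top.
  have sP : (size (grid_poly (s i0) o - grid_poly (s i1) o)%R <= K)%N.
    apply/leq_sizeP=> j; rewrite leq_eqVlt => /predU1P[<-|Kj].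
      by rewrite coefB topE subrr.
    by rewrite coefB !coef_poly !ltnS leqNgt Kj subrr.
  apply/eqP; rewrite -subr_eq0; apply/eqP.
  apply: (@poly_eq_on_roots _ _ _ [seq x l | l <- enum (~: [set i0; i1])]).
  - by rewrite map_inj_uniq ?enum_uniq.
  - rewrite size_map -cardE cardsCs setCK card_ord cards2.
    by rewrite -val_eqE i1E /= subSS subn1.
  - by rewrite size_poly0.
  move=> h /mapP[l]; rewrite mem_enum !inE negb_or => /andP[l0 l1] ->{h}.
  by rewrite hornerD hornerN !sz // subrr horner0.
exists (s i0) => l; case: (eqVneq l i0) => [->|l0]; last exact: sy.
by rewrite s01 sy // -val_eqE i1E.
Qed.

(** The 2 subtracted in the exponent is the cost of prescribing the one top coefficient of size
    about [m ^ 2]. *)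
Lemma card_grid_index :
  #|grid_index| = (m ^ (D.+2 * K.+1 - 2))%N.
Proof.
rewrite card_prod !card_ffun !card_ord -!expnM -expnD.
by congr (m ^ _)%N; lia.
Qed.

Lemma card_grid_value_ge : (0 < D)%N -> (0 < c)%N ->
  (m ^ D.+2 <= #|grid_value|)%N.
Proof.
move=> D0 c0; rewrite card_prod card_ffun !card_ord -addn2 expnD.
have g0 : (0 < K.+1 * c ^ K)%N by rewrite muln_gt0 expn_gt0 c0.
apply: leq_mul.
  by rewrite leq_exp2r // (leq_trans _ (leqnSn _)) // leq_pmull.
by rewrite (leq_trans _ (leqnSn _)) // /grid_bound2 mulnA leq_pmull // muln_gt0 g0.
Qed.

(** Each of the [D+1] coordinates contributes a factor [2 * D * (K.+1 * c ^ K)], where the 2 absorbs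
    the successor in the range. *)
Lemma card_grid_value_le : (0 < m)%N -> (0 < D)%N -> (0 < c)%N ->
  (#|grid_value| <= (2 * D * (K.+1 * c ^ K)) ^ D.+1 * m ^ D.+2)%N.
Proof.
move=> m0 D0 c0; rewrite card_prod card_ffun !card_ord.
have g0 : (0 < K.+1 * c ^ K)%N by rewrite muln_gt0 expn_gt0 c0.
rewrite /grid_bound /grid_bound2; move: (K.+1 * c ^ K)%N g0 => g g0.
rewrite -[D.+2]addn2 [(m ^ (D + 2))%N]expnD [(_ ^ D.+1)%N]expnSr mulnACA -expnMn.
apply: leq_mul; first by rewrite leq_exp2r //; nia.
have : (0 < m ^ 2)%N by rewrite expn_gt0 m0.
move: (m ^ 2)%N => M M0.
have : (0 < D * g * M)%N by rewrite !muln_gt0 D0 g0.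
by lia.
Qed.

End Grid.

(** * Densities *)

Lemma ler_ln_nat (R : realType) (a b : nat) :
  (0 < a <= b)%N -> ln (a%:R : R) <= ln b%:R.
Proof.
move=> /andP[a0 ab]; rewrite ler_ln ?posrE ?ltr0n ?ler_nat //.
exact: leq_trans ab.
Qed.

Lemma hom_density_gt0 (R : realType) (k : nat) (F H : kgraph k) :
  (0 < #|vertex H|)%N -> (0 < hom_count F H)%N -> 0 < hom_density R F H.
Proof. by move=> nH hFH; rewrite divr_gt0 ?exprn_gt0 ?ltr0n. Qed.

Lemma ln_hom_density (R : realType) (k : nat) (F H : kgraph k) :
  (0 < #|vertex H|)%N -> (0 < hom_count F H)%N ->
  ln (hom_density R F H)
    = ln (hom_count F H)%:R - #|vertex F|%:R * ln #|vertex H|%:R.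
Proof.
move=> nH hFH; rewrite lnM ?lnV ?posrE ?invr_gt0 ?exprn_gt0 ?ltr0n //.
by rewrite lnXn ?ltr0n // mulr_natl.
Qed.

(* With [q = D + 2] the grid hypergraph has about [m^q] vertices and
   [m^(q k - 2)] blocks, so that its edge density is about [m^-(q (r-k) + 2)];
   the loss of 2 is negligible once [D] is large. *)
Lemma expansion_gap_witness (R : realType) (k r : nat) (hk : (1 < k)%N)
    (hkr : (k < r)%N) (F : kgraph k) (hF : has_subgraph (complete k.+1 k) F)
    (d : R) :
  0 <= d < (r - k)%:R^-1 ->
  exists H : kgraph r,
    [/\ (0 < #|vertex H|)%N,
        0 < hom_density R (complete r r) H < 1,
        0 < hom_density R (expansion (ltnW hkr) F) H
      & ln (hom_density R (expansion (ltnW hkr) F) H)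
          <= (#|edges F|%:R + d) * ln (hom_density R (complete r r) H)].
Proof.
move=> /andP[d0 d_lt]; set E := expansion _ _.
have v_gt0 : (0 < #|vertex F|)%N.
  by have [gam _ _] := hF; apply/card_gt0P; exists (gam ord0).
have rho_gt0 : 0 < (r - k)%:R :> R by rewrite ltr0n subn_gt0.
set sg := #|edges F|%:R + d.
have sg0 : 0 <= sg by rewrite addr_ge0 // ler0n.
have eta0 : 0 < 1 - (r - k)%:R * d by rewrite subr_gt0 mulrC -ltr_pdivlMr // mul1r.
(* The first summand leaves room for a homomorphism from [E], the second for edges. *)
pose c := (#|vertex E| + r)%N.
have c_gt0 : (0 < c)%N by rewrite /c; lia.
(* In the final comparison the coefficient of [ln m] is [(D+2) * (1 - (r-k) * d) - 2 * sg]; this [D]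
   makes it at least 1. The terms free of [m] add up to [B] below, and [m] is chosen with
   [B <= ln m]. *)
pose D := (Num.bound ((1 + 2 * sg) / (1 - (r - k)%:R * d))).+1.
have D_big : 1 + 2 * sg <= D.+2%:R * (1 - (r - k)%:R * d).
  rewrite -ler_pdivrMr //; apply/ltW/(lt_trans (archi_boundP _)).
    by rewrite divr_ge0 ?(ltW eta0) // addr_ge0 // mulr_ge0.
  by rewrite ltr_nat; exact: leqW (leqW (leqnn D)).
pose C := ((2 * D * (k.-1.+1 * c ^ k.-1)) ^ D.+1)%N.
pose c' := (c ^ (1 + #|edges F| * (r - k)))%N.
pose B : R := ln c'%:R + sg * (r%:R * ln (c * C)%:R).
pose m := Num.bound (expR B).
have lt_m : expR B < m%:R by apply/archi_boundP/expR_ge0.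
have m_gt0 : (0 < m)%N by rewrite -(ltr0n R) (lt_trans _ lt_m) ?expR_gt0.
have lm_big : B <= ln m%:R.
  by rewrite -[B]expRK ler_ln ?posrE ?expR_gt0 ?ltr0n ?(ltW lt_m).
pose L := @grid_line k.-1 D c m; pose H := block_graph L r.
have kE' : k.-1.+1 = k by lia.
have det : blocks_determined L k.
  by rewrite -[X in blocks_determined _ X]kE'; apply: grid_determined.
have cliq : cliques_in_blocks L k.
  by rewrite -[X in cliques_in_blocks _ X]kE'; apply: grid_cliques => //; lia.
have cardT : #|grid_index k.-1 D m| = (m ^ (D.+2 * k - 2))%N.
  by rewrite card_grid_index // kE'.
have T_gt0 : (0 < #|grid_index k.-1 D m|)%N by rewrite cardT expn_gt0 m_gt0.
have nE : #|vertex H| = (c * #|grid_value k.-1 D c m|)%N by rewrite card_prod card_ord.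
have n_ge : (m ^ D.+2 <= #|vertex H|)%N.
  rewrite nE; apply: leq_trans (leq_pmull _ c_gt0).
  exact: card_grid_value_ge.
have n_le : (#|vertex H| <= c * C * m ^ D.+2)%N.
  by rewrite nE -mulnA leq_mul2l card_grid_value_le ?orbT.
have n_gt0 : (0 < #|vertex H|)%N by rewrite (leq_trans _ n_ge) ?expn_gt0 ?m_gt0.
have hK_ge : (m ^ (D.+2 * k - 2) <= hom_count (complete r r) H)%N.
  rewrite -cardT; apply: (block_edge_hom_ge det).
  by rewrite card_ord (ltnW hkr) leq_addl.
have hK_gt0 : (0 < hom_count (complete r r) H)%N.
  by rewrite (leq_trans _ hK_ge) ?expn_gt0 ?m_gt0.
have hE_gt0 : (0 < hom_count E H)%N.
  by apply: block_hom_gt0 => //; rewrite card_ord leq_addr.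
exists H; split=> //.
- rewrite hom_density_gt0 //= ltr_pdivrMr ?exprn_gt0 ?ltr0n // mul1r -natrX.
  by rewrite ltr_nat card_ord block_edge_hom_lt // (ltn_trans hk).
- exact: hom_density_gt0.
rewrite !ln_hom_density // card_expansion_vertex card_ord.
set ln_n := ln #|vertex H|%:R; set lm := ln m%:R in lm_big.
have ln_n_ge : D.+2%:R * lm <= ln_n.
  by rewrite mulr_natl -lnXn ?ltr0n // -natrX ler_ln_nat // n_ge expn_gt0 m_gt0.
have ln_n_le : ln_n <= ln (c * C)%:R + D.+2%:R * lm.
  rewrite mulr_natl -lnXn ?ltr0n // -natrX -lnM ?posrE ?ltr0n ?expn_gt0 ?m_gt0 //.
    by rewrite -natrM ler_ln_nat // n_gt0.
  by have := leq_trans n_gt0 n_le; rewrite muln_gt0 => /andP[].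
have ln_hK : (D.+2%:R * k%:R - 2) * lm <= ln (hom_count (complete r r) H)%:R.
  rewrite -natrM -natrB; last by lia.
  by rewrite mulr_natl -lnXn ?ltr0n // -natrX ler_ln_nat // hK_ge expn_gt0 m_gt0.
have ln_hE : ln (hom_count E H)%:R <= (#|vertex F|%:R - 1) * ln_n + ln c'%:R.
  have := expansion_hom_le hkr hk det cliq hF; rewrite card_ord -/c' => hE_le.
  have -> : #|vertex F|%:R - 1 = (#|vertex F|.-1)%:R :> R.
    by rewrite -subn1 natrB.
  rewrite mulr_natl -lnXn ?ltr0n // -natrX -lnM ?posrE ?ltr0n ?expn_gt0 ?n_gt0 ?c_gt0 //.
  by rewrite -natrM ler_ln_nat // hE_gt0.
have rE : r%:R = k%:R + (r - k)%:R :> R by rewrite -natrD subnKC // ltnW.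
have lm_ge0 : 0 <= lm by rewrite ln_ge0 // ler1n.
set h_K := ln (hom_count (complete r r) H)%:R in ln_hK *.
set h_E := ln (hom_count E H)%:R in ln_hE *.
(* The net coefficient of [ln_n] is negative here and in [lb_K]: the upper bound on [h_E] needs [n]
   large, the lower bound on [h_K] needs [n] small. *)
have ub_E : h_E - (#|vertex F| + #|edges F| * (r - k))%:R * ln_n
    <= ln c'%:R - (1 + #|edges F|%:R * (r - k)%:R) * (D.+2%:R * lm).
  have : (1 + #|edges F|%:R * (r - k)%:R) * (D.+2%:R * lm)
      <= (1 + #|edges F|%:R * (r - k)%:R) * ln_n.
    by rewrite ler_wpM2l // addr_ge0 // mulr_ge0.
  by move: ln_hE; rewrite natrD natrM; lra.
have lb_K : - ((D.+2%:R * (r - k)%:R + 2) * lm + r%:R * ln (c * C)%:R)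
    <= h_K - r%:R * ln_n.
  have : r%:R * ln_n <= r%:R * (ln (c * C)%:R + D.+2%:R * lm).
    by rewrite ler_wpM2l.
  by move: ln_hK; rewrite rE; lra.
apply: le_trans ub_E _; apply: le_trans (ler_wpM2l sg0 lb_K).
have : lm <= (D.+2%:R * (1 - (r - k)%:R * d) - 2 * sg) * lm.
  by rewrite ler_peMl //; move: D_big; lra.
by move: lm_big; rewrite /B /sg; lra.
Qed.

Theorem theorem1p11 (R : realType) (k r : nat) (hk : (2 <= k)%N)
    (hkr : (k < r)%N) (F : kgraph k)
    (hF : has_subgraph (complete k.+1 k) F) :
  ((((r - k)%:R^-1)%:E : \bar R) <= sidorenko_gap R (expansion (ltnW hkr) F))%E
  /\ ~ sidorenko R (expansion (ltnW hkr) F).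
Proof.
have rho_gt0 : 0 < (r - k)%:R^-1 :> R by rewrite invr_gt0 ltr0n subn_gt0.
split.
  apply/lee_addgt0Pr => eps eps0.
  pose d := Num.max 0 ((r - k)%:R^-1 - eps).
  have d_ok : 0 <= d < (r - k)%:R^-1.
    by rewrite le_max lexx /= gt_max rho_gt0 gtrBl.
  have [H [nH /andP[tK0 tK1] tE0 tE_le]] := expansion_gap_witness hk hkr hF d_ok.
  set tK := hom_density R (complete r r) H in tK0 tK1 tE_le.
  set tE := hom_density R _ H in tE0 tE_le.
  have ln_tK : ln tK < 0 by rewrite ln_lt0 // tK0.
  (* This is the exponent that [H] realizes exactly; dividing [tE_le] by the negative [ln tK]
     reverses it into [d <= s]. *)
  pose s := ln tE / ln tK - #|edges F|%:R.
  have d_le_s : d <= s.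
    by rewrite /s lerBrDl ler_ndivlMr //.
  apply: (@le_trans _ _ (s + eps)%:E).
    by rewrite lee_fin -lerBlDr (le_trans _ d_le_s) // le_max lexx orbT.
  rewrite EFinD leeD2r //; apply: ereal_sup_ubound; exists s => //.
  exists H; split=> //; rewrite -/tK -/tE card_expansion_edges subrK.
  by rewrite /powR gt_eqF // divfK ?lt_eqF // lnK.
(* Any [d] strictly between 0 and [1/(r-k)] works: the density of the expansion is then at most the
   edge density to the power [e(F) + d], strictly below the Sidorenko bound. *)
pose d : R := (r - k)%:R^-1 / 2.
have d_gt0 : 0 < d by rewrite /d; lra.
have d_ok : 0 <= d < (r - k)%:R^-1 by rewrite ltW //= /d; lra.
have [H [nH /andP[tK0 tK1] tE0 tE_le]] := expansion_gap_witness hk hkr hF d_ok.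
move=> /(_ H nH); rewrite card_expansion_edges => sid.
have ln_tK : ln (hom_density R (complete r r) H) < 0 by rewrite ln_lt0 // tK0.
have : #|edges F|%:R * ln (hom_density R (complete r r) H)
    <= ln (hom_density R (expansion (ltnW hkr) F) H).
  by rewrite mulr_natl -lnXn // ler_ln ?posrE ?exprn_gt0.
by move=> /le_trans/(_ tE_le); rewrite mulrDl lerDl leNgt nmulr_llt0 ?d_gt0.
Qed.
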